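(* Let $(A,\cdot_A)$ and $(B,\cdot_B)$ be finite-dimensional pre-Lie algebras over a field $K$, and let $\phi:(A,\cdot_A)\to(B,\cdot_B)$ and $\psi:(B,\cdot_B)\to(A,\cdot_A)$ be pre-Lie algebra homomorphisms such that $\psi\phi=\mathrm{id}_A$. Then for any $0\neq\theta\in K$, the pair $(\phi+\theta\psi^*,\theta\psi+\phi^* )$ is both a coherent homomorphism of skew-symmetric classical $r$-matrices from $r_{\mathrm{id}_A}$ to $r_{\mathrm{id}_B}$ and a coherent homomorphism of Lie bialgebras from $(\mathfrak g(A)\ltimes_{L_A^*}A^*,\delta_{r_{\mathrm{id}_A}})$ to $(\mathfrak g(B)\ltimes_{L_B^*}B^*,\delta_{r_{\mathrm{id}_B}})$. In particular, if $\phi$ is a linear bijection, then $(\phi+\theta(\phi^{-1})^*,\theta\phi^{-1}+\phi^* )$ is both a coherent isomorphism of skew-symmetric classical $r$-matrices from $r_{\mathrm{id}_A}$ to $r_{\mathrm{id}_B}$ and a coherent isomorphism of Lie bialgebras from $(\mathfrak g(A)\ltimes_{L_A^*}A^*,\delta_{r_{\mathrm{id}_A}})$ to $(\mathfrak g(B)\ltimes_{L_B^*}B^*,\delta_{r_{\mathrm{id}_B}})$.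
   Context: A pre-Lie algebra is a vector space $A$ with a bilinear product such that $x\cdot(y\cdot z)-(x\cdot y)\cdot z=y\cdot(x\cdot z)-(y\cdot x)\cdot z$. Its sub-adjacent Lie algebra $\mathfrak g(A)$ is $A$ with $[a,b]=a\cdot b-b\cdot a$, and $L_A(a)b=a\cdot b$ is a representation of $\mathfrak g(A)$ on $A$. For a representation $(V,\rho)$ of a Lie algebra $\mathfrak g$, $\rho^*(x):=-\rho(x)^*$ on $V^*$, and $\mathfrak g\ltimes_{\rho^*}V^*$ is the semi-direct product Lie algebra on $\mathfrak g\oplus V^*$ with $[x+u,y+v]=[x,y]+\rho^*(x)v-\rho^*(y)u$. For linear maps $f_1,f_2$ on summands, $f_1+f_2$ denotes the map $v_1+v_2\mapsto f_1(v_1)+f_2(v_2)$ on the direct sum; $\varphi^*$ is the transpose. Thus $\phi+\theta\psi^*:\mathfrak g(A)\oplus A^*\to\mathfrak g(B)\oplus B^*$ and $\theta\psi+\phi^*:\mathfrak g(B)\oplus B^*\to\mathfrak g(A)\oplus A^*$. With a basis $\{e_i\}$ of $A$ and dual basis $\{e^i\}$, $r_{\mathrm{id}_A}:=\sum_i(e^i\otimes e_i-e_i\otimes e^i)\in(\mathfrak g(A)\ltimes_{L_A^*}A^* )^{\otimes2}$. It is a skew-symmetric classical $r$-matrix, i.e. $r=-\tau(r)$ ($\tau$ the flip) and $[r_{12},r_{13}]+[r_{13},r_{23}]+[r_{12},r_{23}]=0$. For $r$ in $\mathfrak k\otimes\mathfrak k$, $\mathfrak k$ a Lie algebra, $\delta_r(x)=(\mathrm{id}\otimes\mathrm{ad}(x)+\mathrm{ad}(x)\otimes\mathrm{id})(r)$;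 for a skew-symmetric classical $r$-matrix $r$, $(\mathfrak k,[\,,],\delta_r)$ is a Lie bialgebra. Coherent homomorphism of classical $r$-matrices from $r_{\mathfrak g}\in\mathfrak g\otimes\mathfrak g$ to $r_{\mathfrak h}\in\mathfrak h\otimes\mathfrak h$: a pair $(\Phi,\Psi)$ with $\Phi:\mathfrak g\to\mathfrak h$ a Lie algebra homomorphism and $\Psi:\mathfrak h\to\mathfrak g$ linear such that $(\Psi\otimes\mathrm{id}_{\mathfrak h})(r_{\mathfrak h})=(\mathrm{id}_{\mathfrak g}\otimes\Phi)(r_{\mathfrak g})$, $(\mathrm{id}_{\mathfrak h}\otimes\Psi)(r_{\mathfrak h})=(\Phi\otimes\mathrm{id}_{\mathfrak g})(r_{\mathfrak g})$, and $\Psi[\Phi(x),y]_{\mathfrak h}=[x,\Psi(y)]_{\mathfrak g}$ for all $x\in\mathfrak g,y\in\mathfrak h$. Coherent homomorphism of Lie bialgebras from $(\mathfrak g,[\,,]_{\mathfrak g},\delta_{\mathfrak g})$ to $(\mathfrak h,[\,,]_{\mathfrak h},\delta_{\mathfrak h})$: a pair $(\Phi,\Psi)$ where $\Phi:\mathfrak g\to\mathfrak h$ is a Lie algebra homomorphism, $\Psi:\mathfrak h\to\mathfrak g$ is linear with $(\Psi\otimes\Psi)\delta_{\mathfrak h}=\delta_{\mathfrak g}\Psi$, $(\mathrm{id}_{\mathfrak g}\otimes\Phi)\delta_{\mathfrak g}=(\Psi\otimes\mathrm{id}_{\mathfrak h})\delta_{\mathfrak h}\Phi$, and $\Psi[\Phi(x),y]_{\mathfrak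 h}=[x,\Psi(y)]_{\mathfrak g}$ for all $x,y$. In both cases it is a coherent isomorphism if $\Phi$ and $\Psi$ are both bijective. *)

(* Defs.v *)
From HB Require Import structures.
From mathcomp Require Import all_boot all_algebra ssrAC.

Set Implicit Arguments.
Unset Strict Implicit.
Unset Printing Implicit Defensive.

Import GRing.Theory.
Local Open Scope ring_scope.

(* All vector spaces are finite-dimensional: they are [vectType]s over a     *)
(* field of arbitrary characteristic.                                         *)

HB.mixin Record Vector_isPreLie (K : fieldType) A of Vector K A := {
  plmul : A -> A -> A;
  plmul_linearl : forall y, linear (plmul^~ y);
  plmul_linearr : forall x, linear (plmul x);
  plmulP : forall x y z,
    plmul x (plmul y z) - plmul (plmul x y) z =
    plmul y (plmul x z) - plmul (plmul y x) z
}.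

#[short(type="preLieType")]
HB.structure Definition PreLie (K : fieldType) :=
  { A of Vector_isPreLie K A & Vector K A }.

HB.mixin Record Vector_isLie (K : fieldType) L of Vector K L := {
  lie : L -> L -> L;
  lie_linearl : forall y, linear (lie^~ y);
  lie_linearr : forall x, linear (lie x);
  liexx : forall x, lie x x = 0;
  lie_jacobi : forall x y z,
    lie x (lie y z) + lie y (lie z x) + lie z (lie x y) = 0
}.

#[short(type="lieType")]
HB.structure Definition Lie (K : fieldType) :=
  { L of Vector_isLie K L & Vector K L }.

Section Bilinearity.
Variable K : fieldType.

HB.instance Definition _ (A : preLieType K) (x : A) :=
  GRing.isLinear.Build K A A _ (plmul x) (plmul_linearr x).

Lemma plmulDl (A : preLieType K) (x y z : A) :
  plmul (x + y) z = plmul x z + plmul y z.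
Proof. by have := plmul_linearl z 1 x y; rewrite !scale1r. Qed.

Lemma plmul0l (A : preLieType K) (z : A) : plmul 0 z = 0.
Proof. by apply: (addrI (plmul 0 z)); rewrite -plmulDl !addr0. Qed.

Lemma plmulNl (A : preLieType K) (x z : A) : plmul (- x) z = - plmul x z.
Proof. by apply: (addrI (plmul x z)); rewrite -plmulDl !subrr plmul0l. Qed.

Lemma plmulBl (A : preLieType K) (x y z : A) :
  plmul (x - y) z = plmul x z - plmul y z.
Proof. by rewrite plmulDl plmulNl. Qed.

Lemma plmulZl (A : preLieType K) c (x z : A) :
  plmul (c *: x) z = c *: plmul x z.
Proof. by have := plmul_linearl z c x 0; rewrite !addr0 plmul0l addr0. Qed.

HB.instance Definition _ (L : lieType K) (x : L) :=
  GRing.isLinear.Build K L L _ (lie x) (lie_linearr x).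

Lemma lieDl (L : lieType K) (x y z : L) : lie (x + y) z = lie x z + lie y z.
Proof. by have := lie_linearl z 1 x y; rewrite !scale1r. Qed.

Lemma lie0l (L : lieType K) (z : L) : lie 0 z = 0.
Proof. by apply: (addrI (lie 0 z)); rewrite -lieDl !addr0. Qed.

Lemma lieZl (L : lieType K) c (x z : L) : lie (c *: x) z = c *: lie x z.
Proof. by have := lie_linearl z c x 0; rewrite !addr0 lie0l addr0. Qed.

Lemma lieC (L : lieType K) (x y : L) : lie x y = - lie y x.
Proof.
have := liexx (x + y); rewrite lieDl !linearD /= !liexx add0r addr0.
by move/eqP; rewrite addr_eq0 => /eqP.
Qed.

End Bilinearity.

Lemma linfunE (K : fieldType) (V W : vectType K) (f : V -> W) :
  linear f -> linfun f =1 f.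
Proof.
move=> lin_f; pose F : {linear V -> W} :=
  HB.pack f (GRing.isLinear.Build _ _ _ _ _ lin_f).
exact: (lfunE F).
Qed.

Lemma comm_lfunE (K : fieldType) (V : vectType K) (f g : 'End(V)) v :
  ((f \o g)%VF - (g \o f)%VF) v = f (g v) - g (f v).
Proof. by rewrite add_lfunE opp_lfunE !comp_lfunE. Qed.

Definition prelie_hom (K : fieldType) (A B : preLieType K) (f : 'Hom(A, B)) :=
  forall x y, f (plmul x y) = plmul (f x) (f y).

Definition lie_hom (K : fieldType) (g h : lieType K) (f : 'Hom(g, h)) :=
  forall x y, f (lie x y) = lie (f x) (f y).

Section SubAdjacent.
Variable K : fieldType.

Definition subadjacent (A : preLieType K) : Type := A.

Variable A : preLieType K.
HB.instance Definition _ := Vector.on (subadjacent A).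

Definition commutator (x y : subadjacent A) : subadjacent A :=
  plmul (x : A) (y : A) - plmul (y : A) (x : A).

Fact commutator_linearl y : linear (commutator^~ y).
Proof.
move=> c u v; rewrite /commutator plmulDl plmulZl linearP /=.
by rewrite scalerBr opprD addrACA.
Qed.

Fact commutator_linearr x : linear (commutator x).
Proof.
move=> c u v; rewrite /commutator plmulDl plmulZl linearP /=.
by rewrite scalerBr opprD addrACA.
Qed.

Fact commutatorxx x : commutator x x = 0.
Proof. exact: subrr. Qed.

Fact jacobi_rearrange (V : zmodType) (a b c d e f g h i j k l : V) :
  a - b = c - d -> e - f = g - h -> i - j = k - l ->
  a - k + (- f - - h) + (e - c + (- j - - l)) + (i - g + (- b - - d)) = 0.
Proof.
move=> /eqP; rewrite -subr_eq0 => /eqP E1 /eqP; rewrite -subr_eq0 => /eqP E2.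
move=> /eqP; rewrite -subr_eq0 => /eqP E3.
transitivity
    ((a - b - (c - d)) + (e - f - (g - h)) + (i - j - (k - l))); last first.
  by rewrite E1 E2 E3 !addr0.
rewrite !opprK !opprB !addrA.
by rewrite [LHS](ACl (1*11*12*6*5*3*4*10*9*7*8*2)).
Qed.

Fact commutator_jacobi x y z :
  commutator x (commutator y z) + commutator y (commutator z x)
    + commutator z (commutator x y) = 0.
Proof.
rewrite /commutator !plmulBl !linearB /=.
exact: (jacobi_rearrange (plmulP _ _ _) (plmulP _ _ _) (plmulP _ _ _)).
Qed.

HB.instance Definition _ := Vector_isLie.Build K (subadjacent A)
  commutator_linearl commutator_linearr commutatorxx commutator_jacobi.

Lemma lie_subadjacentE (x y : A) :
  lie (x : subadjacent A) (y : subadjacent A) = plmul x y - plmul y x :> A.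
Proof. by []. Qed.

End SubAdjacent.

Section Dual.
Variable K : fieldType.

Definition dual (V : vectType K) : Type := 'Hom(V, K^o).
HB.instance Definition _ V := Vector.on (dual V).

Definition pairing (V : vectType K) (xi : dual V) (v : V) : K :=
  (xi : 'Hom(V, K^o)) v.

Lemma pairingDl (V : vectType K) (xi zeta : dual V) v :
  pairing (xi + zeta) v = pairing xi v + pairing zeta v.
Proof. by rewrite /pairing add_lfunE. Qed.

Lemma pairingNl (V : vectType K) (xi : dual V) v :
  pairing (- xi) v = - pairing xi v.
Proof. by rewrite /pairing opp_lfunE. Qed.

Lemma pairingZl (V : vectType K) c (xi : dual V) v :
  pairing (c *: xi) v = c * pairing xi v.
Proof. by rewrite /pairing scale_lfunE. Qed.

Lemma pairingDr (V : vectType K) (xi : dual V) u v :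
  pairing xi (u + v) = pairing xi u + pairing xi v.
Proof. by rewrite /pairing linearD. Qed.

Lemma pairingNr (V : vectType K) (xi : dual V) v :
  pairing xi (- v) = - pairing xi v.
Proof. by rewrite /pairing linearN. Qed.

Lemma pairingZr (V : vectType K) c (xi : dual V) v :
  pairing xi (c *: v) = c * pairing xi v.
Proof. by rewrite /pairing linearZ. Qed.

Lemma pairing_suml (V : vectType K) n (xi : 'I_n -> dual V) v :
  pairing (\sum_i xi i) v = \sum_i pairing (xi i) v.
Proof.
apply: (big_morph (fun zeta => pairing zeta v)) => [zeta zeta'|].
  exact: pairingDl.
by have := pairingZl 0 (0 : dual V) v; rewrite scale0r mul0r.
Qed.

Lemma pairing_sumr (V : vectType K) n (xi : dual V) (v : 'I_n -> V) :
  pairing xi (\sum_i v i) = \sum_i pairing xi (v i).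
Proof. by rewrite /pairing linear_sum. Qed.

Definition pairing_simp :=
  (pairingDl, pairingNl, pairingZl, pairingDr, pairingNr, pairingZr).

Definition transpose (V W : vectType K) (f : 'Hom(V, W)) :
    'Hom(dual W, dual V) :=
  linfun (fun xi : dual W => ((xi : 'Hom(W, K^o)) \o f)%VF : dual V).

Lemma dualP (V : vectType K) (xi zeta : dual V) :
  (forall v, pairing xi v = pairing zeta v) <-> xi = zeta.
Proof. by split=> [E|-> //]; apply/(@lfunP K V K^o). Qed.

Lemma pairing_comp (V W : vectType K) (f : 'Hom(V, W)) (xi : dual W) v :
  pairing ((xi : 'Hom(W, K^o)) \o f)%VF v = pairing xi (f v).
Proof. by rewrite /pairing comp_lfunE. Qed.

Fact transpose_linear (V W : vectType K) (f : 'Hom(V, W)) :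
  linear (fun xi : dual W => ((xi : 'Hom(W, K^o)) \o f)%VF : dual V).
Proof.
move=> c xi zeta; apply/dualP=> v.
by rewrite !pairing_simp !pairing_comp !pairing_simp.
Qed.

Lemma transposeE (V W : vectType K) (f : 'Hom(V, W)) (xi : dual W) v :
  pairing (transpose f xi) v = pairing xi (f v).
Proof.
by rewrite /transpose (linfunE (transpose_linear f)) pairing_comp.
Qed.

End Dual.

Record lieRep (K : fieldType) (g : lieType K) (V : vectType K) := LieRep {
  rep_map :> g -> 'End(V);
  rep_linear : linear rep_map;
  rep_lie : forall x y,
    rep_map (lie x y) =
      (rep_map x \o rep_map y)%VF - (rep_map y \o rep_map x)%VF
}.

Section Representations.
Variable K : fieldType.

Section LeftMultiplication.
Variable A : preLieType K.

Definition Lmul (a : subadjacent A) : 'End(A) := linfun (plmul (a : A)).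

Fact Lmul_linear : linear Lmul.
Proof.
move=> c a b; apply/lfunP=> v.
by rewrite add_lfunE scale_lfunE !lfunE /= plmulDl plmulZl.
Qed.

Fact Lmul_lie x y :
  Lmul (lie x y) = (Lmul x \o Lmul y)%VF - (Lmul y \o Lmul x)%VF.
Proof.
apply/lfunP=> v; rewrite comm_lfunE !lfunE /=.
rewrite plmulBl; apply/eqP; rewrite subr_eq addrAC eq_sym subr_eq addrC.
have /eqP := plmulP (x : A) y v; rewrite subr_eq => /eqP ->.
by rewrite [X in X == _]addrC addrAC subrK addrC.
Qed.

Definition Lrep : lieRep (subadjacent A) A := LieRep Lmul_linear Lmul_lie.
End LeftMultiplication.

Section DualRep.
Variables (g : lieType K) (V : vectType K) (rho : lieRep g V).

Definition dual_map (x : g) : 'End(dual V) := - transpose (rho x).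

Lemma dual_mapE x xi v :
  pairing (dual_map x xi) v = - pairing xi (rho x v).
Proof.
by rewrite /dual_map opp_lfunE pairingNl transposeE.
Qed.

Fact dual_map_linear : linear dual_map.
Proof.
move=> c x y; apply/lfunP=> xi; apply/dualP=> v.
rewrite add_lfunE scale_lfunE !pairing_simp !dual_mapE.
by rewrite rep_linear add_lfunE scale_lfunE !pairing_simp opprD mulrN.
Qed.

Fact dual_map_lie x y :
  dual_map (lie x y) =
    (dual_map x \o dual_map y)%VF - (dual_map y \o dual_map x)%VF.
Proof.
apply/lfunP=> xi; apply/dualP=> v.
rewrite dual_mapE rep_lie !comm_lfunE !pairing_simp !dual_mapE !opprK opprB.
by rewrite addrC.
Qed.

Definition dual_rep : lieRep g (dual V) := LieRep dual_map_linear dual_map_lie.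
End DualRep.

End Representations.

Section SemiDirect.
Variable K : fieldType.

Definition semidirect (g : lieType K) (V : vectType K) (rho : lieRep g V) :
  Type := (g * V)%type.

Variables (g : lieType K) (V : vectType K) (rho : lieRep g V).
HB.instance Definition _ := Vector.on (semidirect rho).

Definition sd_lie (p q : semidirect rho) : semidirect rho :=
  (lie p.1 q.1, rho p.1 q.2 - rho q.1 p.2).

Fact sd_lie_linearl q : linear (sd_lie^~ q).
Proof.
move=> c p p'; congr (_, _) => /=; first exact: lie_linearl.
rewrite rep_linear add_lfunE scale_lfunE linearP /= scalerBr opprD.
by rewrite addrACA.
Qed.

Fact sd_lie_linearr p : linear (sd_lie p).
Proof.
move=> c q q'; congr (_, _) => /=; first exact: lie_linearr.
rewrite rep_linear add_lfunE scale_lfunE linearP /= scalerBr opprD.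
by rewrite addrACA.
Qed.

Fact sd_liexx p : sd_lie p p = 0.
Proof. by rewrite /sd_lie liexx subrr. Qed.

Fact sd_lie_jacobi p q r :
  sd_lie p (sd_lie q r) + sd_lie q (sd_lie r p) + sd_lie r (sd_lie p q) = 0.
Proof.
congr (_, _) => /=; first exact: lie_jacobi.
rewrite !rep_lie !linearB /=; rewrite !comm_lfunE.
rewrite !opprB !addrA [LHS](ACl (1*12*7*2*3*10*5*4*11*6*9*8)) /=.
by rewrite !addrK subrr.
Qed.

HB.instance Definition _ := Vector_isLie.Build K (semidirect rho)
  sd_lie_linearl sd_lie_linearr sd_liexx sd_lie_jacobi.

Lemma lie_semidirectE (p q : semidirect rho) :
  lie p q = (lie p.1 q.1, rho p.1 q.2 - rho q.1 p.2).
Proof. by []. Qed.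

Definition sd_inl (x : g) : semidirect rho := (x, 0).
Definition sd_inr (u : V) : semidirect rho := (0, u).

End SemiDirect.
Arguments sd_inl {K g V} rho x.
Arguments sd_inr {K g V} rho u.

Definition sd_map (K : fieldType) (g h : lieType K) (V W : vectType K)
    (rho : lieRep g V) (pi : lieRep h W) (f1 : 'Hom(g, h)) (f2 : 'Hom(V, W)) :
    'Hom(semidirect rho, semidirect pi) :=
  linfun (fun p : semidirect rho => (f1 p.1, f2 p.2) : semidirect pi).

Lemma sd_mapE (K : fieldType) (g h : lieType K) (V W : vectType K)
    (rho : lieRep g V) (pi : lieRep h W) (f1 : 'Hom(g, h)) (f2 : 'Hom(V, W)) p :
  sd_map rho pi f1 f2 p = (f1 p.1, f2 p.2).
Proof.
by rewrite linfunE // => c x y; congr (_, _); rewrite /= linearP.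
Qed.

Section TensorProduct.
Variable K : fieldType.

(* In finite dimension V (x) W is modelled by Hom(V^*, W), the pure tensor    *)
(* v (x) w being xi |-> xi(v) w; [tliftE] and [tlift_unique] are the          *)
(* universal property, through which every map out of it is defined; [tlift]  *)
(* is meaningful only on bilinear maps.                                       *)
Definition tensor (V W : vectType K) : Type := 'Hom(dual V, W).
HB.instance Definition _ V W := Vector.on (tensor V W).

Definition pure (V W : vectType K) (v : V) (w : W) : tensor V W :=
  linfun (fun xi : dual V => pairing xi v *: w).

Definition cobasis n (V : vectType K) (X : n.-tuple V) (i : 'I_n) : dual V :=
  linfun (coord X i : V -> K^o).

Lemma cobasisE n (V : vectType K) (X : n.-tuple V) i v :
  pairing (cobasis X i) v = coord X i v.
Proof. by rewrite /pairing linfunE // => c x y; rewrite linearP. Qed.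

Fact pure_linear (V W : vectType K) (v : V) (w : W) :
  linear (fun xi : dual V => pairing xi v *: w).
Proof. by move=> c xi zeta; rewrite !pairing_simp scalerDl scalerA. Qed.

Lemma pureE (V W : vectType K) (v : V) (w : W) (xi : dual V) :
  (pure v w : 'Hom(dual V, W)) xi = pairing xi v *: w.
Proof. exact: (linfunE (pure_linear v w)). Qed.

Lemma tensor_applyP (V W : vectType K) c (t t' : tensor V W) (xi : dual V) :
  (c *: t + t' : 'Hom(dual V, W)) xi =
  c *: (t : 'Hom(dual V, W)) xi + (t' : 'Hom(dual V, W)) xi.
Proof. by rewrite -scale_lfunE -add_lfunE. Qed.

Definition is_bilinear (V W Z : vectType K) (beta : V -> W -> Z) :=
  (forall w, linear (beta^~ w)) /\ (forall v, linear (beta v)).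

Definition tlift (V W Z : vectType K) (beta : V -> W -> Z)
    (t : tensor V W) : Z :=
  let e := vbasis {:V} in
  \sum_(i < \dim {:V}) beta e`_i ((t : 'Hom(dual V, W)) (cobasis e i)).

Lemma linear_comb (V W : vectType K) (f : V -> W) n (c : 'I_n -> K)
    (v : 'I_n -> V) :
  linear f -> f (\sum_i c i *: v i) = \sum_i c i *: f (v i).
Proof.
move=> lin_f; rewrite -(linfunE lin_f) linear_sum /=.
by apply: eq_bigr => i _; rewrite linearZ /= (linfunE lin_f).
Qed.

Lemma cobasis_expand n (V : vectType K) (X : n.-tuple V) (xi : dual V) :
  basis_of {:V} X -> xi = \sum_(i < n) pairing xi X`_i *: cobasis X i.
Proof.
move=> basisX; apply/dualP => v.
rewrite {1}(coord_basis basisX (memvf v)) pairing_sumr pairing_suml.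
by apply: eq_bigr => i _; rewrite !pairing_simp cobasisE mulrC.
Qed.

Lemma tensor_expand n (V W : vectType K) (X : n.-tuple V) (t : tensor V W) :
  basis_of {:V} X ->
  t = \sum_(i < n) pure X`_i ((t : 'Hom(dual V, W)) (cobasis X i)).
Proof.
move=> basisX; apply/(@lfunP K (dual V) W) => xi.
rewrite {1}(cobasis_expand xi basisX) linear_sum sum_lfunE.
by apply: eq_bigr => i _; rewrite linearZ pureE.
Qed.

Lemma pure_bilinear (V W : vectType K) : is_bilinear (@pure V W).
Proof.
split=> [w c v v'|v c w w']; apply/(@lfunP K (dual V) W) => xi;
  rewrite tensor_applyP !pureE.
  by rewrite !pairing_simp scalerDl scalerA.
by rewrite scalerDr !scalerA mulrC.
Qed.

Lemma tlift_linear (V W Z : vectType K) (beta : V -> W -> Z) :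
  is_bilinear beta -> linear (tlift beta).
Proof.
move=> [_ betar] c t t'; rewrite /tlift scaler_sumr -big_split /=.
by apply: eq_bigr => i _; rewrite tensor_applyP betar.
Qed.

Lemma tliftE (V W Z : vectType K) (beta : V -> W -> Z) v w :
  is_bilinear beta -> tlift beta (pure v w) = beta v w.
Proof.
move=> [betal betar].
rewrite {2}(coord_vbasis (memvf v)) (linear_comb _ _ (betal w)).
apply: eq_bigr => i _; rewrite pureE cobasisE.
have := betar (vbasis {:V})`_i (coord (vbasis {:V}) i v) w 0.
have := betar (vbasis {:V})`_i (-1) 0 0.
by rewrite !addr0 scaler0 scaleN1r addNr => ->; rewrite addr0.
Qed.

Lemma tlift_unique (V W Z : vectType K) (beta : V -> W -> Z) (f : tensor V W -> Z) :
  linear f -> (forall v w, f (pure v w) = beta v w) -> f =1 tlift beta.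
Proof.
move=> lin_f fE t; rewrite {1}(tensor_expand t (vbasisP {:V})).
under eq_bigr => i _ do rewrite -[pure _ _]scale1r.
rewrite (linear_comb _ _ lin_f); apply: eq_bigr => i _.
by rewrite scale1r fE.
Qed.

Lemma dual_bases_sum (V Z : vectType K) (beta : dual V -> V -> Z) m n
    (X : m.-tuple V) (Y : n.-tuple V) :
  is_bilinear beta -> basis_of {:V} X -> basis_of {:V} Y ->
  \sum_(i < m) beta (cobasis X i) X`_i = \sum_(i < n) beta (cobasis Y i) Y`_i.
Proof.
move=> [betal betar] basisX basisY.
under [RHS]eq_bigr => j _ do
  rewrite (cobasis_expand (cobasis Y j) basisX) (linear_comb _ _ (betal _)).
rewrite exchange_big /=; apply: eq_bigr => i _.
rewrite {1}(coord_basis basisY (memvf X`_i)) (linear_comb _ _ (betar _)).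
by apply: eq_bigr => j _; rewrite cobasisE.
Qed.

Definition tmap (V W V' W' : vectType K) (f : V -> V') (g : W -> W') :
    tensor V W -> tensor V' W' :=
  tlift (fun v w => pure (f v) (g w)).

Definition flip (V W : vectType K) : tensor V W -> tensor W V :=
  tlift (fun v w => pure w v).

(* a (x) (b (x) c) |-> b (x) (c (x) a) *)
Definition rot3 (V : vectType K) :
    tensor V (tensor V V) -> tensor V (tensor V V) :=
  tlift (fun a => tlift (fun b c => pure b (pure c a))).

End TensorProduct.

Section ClassicalYangBaxter.
Variables (K : fieldType) (g : lieType K).

Definition skew_symmetric (r : tensor g g) := r = - flip r.

(* [r12, r13] for r = sum a (x) b is sum [a, c] (x) b (x) d over pairs of     *)
(* summands a (x) b and c (x) d, and similarly for the other two brackets.    *)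
Definition lie12_13 (r : tensor g g) : tensor g (tensor g g) :=
  tlift (fun a b => tlift (fun c d => pure (lie a c) (pure b d)) r) r.
Definition lie13_23 (r : tensor g g) : tensor g (tensor g g) :=
  tlift (fun a b => tlift (fun c d => pure a (pure c (lie b d))) r) r.
Definition lie12_23 (r : tensor g g) : tensor g (tensor g g) :=
  tlift (fun a b => tlift (fun c d => pure a (pure (lie b c) d)) r) r.

Definition classical_rmatrix (r : tensor g g) :=
  lie12_13 r + lie13_23 r + lie12_23 r = 0.

Definition tensor_ad (x : g) (t : tensor g g) : tensor g g :=
  tmap id (lie x) t + tmap (lie x) id t.

Definition delta_r (r : tensor g g) (x : g) : tensor g g := tensor_ad x r.

(* The co-bracket takes values in Im (id - flip), which is equivalent to      *)
(* skew-symmetry outside characteristic 2 and in characteristic 2 is what     *)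
(* makes the dual bracket alternating.                                        *)
Definition lie_bialgebra (delta : g -> tensor g g) :=
  [/\ linear delta,
      forall x, exists t, delta x = t - flip t,
      forall x, let t := tmap id delta (delta x) in
        t + rot3 t + rot3 (rot3 t) = 0
    & forall x y,
        delta (lie x y) = tensor_ad x (delta y) - tensor_ad y (delta x)].

End ClassicalYangBaxter.

Section CoherentHomomorphisms.
Variables (K : fieldType) (g h : lieType K).
Implicit Types (Phi : 'Hom(g, h)) (Psi : 'Hom(h, g)).

Definition skew_rmatrix (k : lieType K) (r : tensor k k) :=
  skew_symmetric r /\ classical_rmatrix r.

Definition coherent_rmatrix_hom (rg : tensor g g) (rh : tensor h h) Phi Psi :=
  [/\ skew_rmatrix rg /\ skew_rmatrix rh,
      lie_hom Phi,
      tmap Psi id rh = tmap id Phi rg,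
      tmap id Psi rh = tmap Phi id rg
    & forall x y, Psi (lie (Phi x) y) = lie x (Psi y)].

Definition coherent_bialgebra_hom (dg : g -> tensor g g) (dh : h -> tensor h h)
    Phi Psi :=
  [/\ lie_bialgebra dg /\ lie_bialgebra dh,
      lie_hom Phi,
      forall y, tmap Psi Psi (dh y) = dg (Psi y),
      forall x, tmap id Phi (dg x) = tmap Psi id (dh (Phi x))
    & forall x y, Psi (lie (Phi x) y) = lie x (Psi y)].

Definition coherent_rmatrix_iso (rg : tensor g g) (rh : tensor h h) Phi Psi :=
  [/\ coherent_rmatrix_hom rg rh Phi Psi, bijective Phi & bijective Psi].

Definition coherent_bialgebra_iso (dg : g -> tensor g g) (dh : h -> tensor h h)
    Phi Psi :=
  [/\ coherent_bialgebra_hom dg dh Phi Psi, bijective Phi & bijective Psi].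

End CoherentHomomorphisms.

Section PreLieDouble.
Variable K : fieldType.

Definition prelie_double (A : preLieType K) : lieType K :=
  semidirect (dual_rep (Lrep A)).

Definition r_basis (A : preLieType K) n (e : n.-tuple A) :
    tensor (prelie_double A) (prelie_double A) :=
  let inA : A -> prelie_double A := sd_inl (dual_rep (Lrep A)) in
  let inA' : dual A -> prelie_double A := sd_inr (dual_rep (Lrep A)) in
  \sum_(i < n) (pure (inA' (cobasis e i)) (inA e`_i)
                - pure (inA e`_i) (inA' (cobasis e i))).

Definition r_id (A : preLieType K) := r_basis (vbasis {:A}).

Lemma r_idE (A : preLieType K) n (e : n.-tuple A) :
  basis_of {:A} e -> r_id A = r_basis e.
Proof.
move=> basis_e; have [purel purer] := @pure_bilinear K
  (prelie_double A) (prelie_double A).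
apply: (dual_bases_sum (beta := fun xi v =>
  pure (sd_inr (dual_rep (Lrep A)) xi) (sd_inl (dual_rep (Lrep A)) v)
  - pure (sd_inl (dual_rep (Lrep A)) v) (sd_inr (dual_rep (Lrep A)) xi)
  : tensor (prelie_double A) (prelie_double A))) => //; last exact: vbasisP.
split=> [v c xi zeta|xi c u v] /=.
  have -> : sd_inr (dual_rep (Lrep A)) (c *: xi + zeta) =
    c *: sd_inr (dual_rep (Lrep A)) xi + sd_inr (dual_rep (Lrep A)) zeta.
    by congr (_, _); rewrite /= scaler0 addr0.
  by rewrite purel purer scalerBr opprD addrACA.
have -> : sd_inl (dual_rep (Lrep A)) (c *: u + v) =
  c *: sd_inl (dual_rep (Lrep A)) u + sd_inl (dual_rep (Lrep A)) v.
  by congr (_, _); rewrite /= scaler0 addr0.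
by rewrite purel purer scalerBr opprD addrACA.
Qed.

Definition double_map (A B : preLieType K) (f : 'Hom(A, B))
    (f' : 'Hom(dual A, dual B)) : 'Hom(prelie_double A, prelie_double B) :=
  sd_map (dual_rep (Lrep A)) (dual_rep (Lrep B)) f f'.

End PreLieDouble.

(* Main.v *)
(* Jacobi, skew-symmetry of [r] and the Yang-Baxter equation make [delta_r] a *)
(* Lie bialgebra structure, and a coherent homomorphism of r-matrices is      *)
(* automatically one of Lie bialgebras, so only the r-matrix statement        *)
(* requires work.  There everything rests on one identity for dual bases:     *)
(*   sum_j f^*(y^j) (x) y_j = sum_i x^i (x) f(x_i).                           *)
(* With [f = phi] and [f = psi] it gives the two leg conditions, and with [f] *)
(* a left multiplication it makes the terms of the Yang-Baxter equation of    *)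
(* [r_id A] cancel in pairs.  The relation [psi phi = id] enters through the  *)
(* bracket conditions alone.                                                  *)
Require Import Defs.
From mathcomp Require Import all_boot all_algebra ssrAC.
Import GRing.Theory.
Local Open Scope ring_scope.
Set Implicit Arguments.
Unset Strict Implicit.
Unset Printing Implicit Defensive.

(** Let [x_i] and [x^i] be dual bases of [A]. In the double, the covectors commute with each other
    and [A] acts on them by minus the transpose of left multiplication. In the canonical element,
    the sum of the [x^i (x) x_i], applying a map to the vectors is the same as applying its
    transpose to the covectors ([canonical_sum_transpose]). Taking left multiplications for the map
    turns the three Yang-Baxter brackets of [r_id A] into signed sums with one product of two basis
    vectors on one leg and covectors on the other two; each such sum occurs once with each sign
    ([canonical_classical_rmatrix]). Taking [phi] and [psi] gives the two leg conditions, [theta]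
    being carried across the tensor sign.

    The bracket conditions are checked by pairing with vectors. They rest on
    [psi (plmul (phi x) y) = plmul x (psi y)], which follows from [psi] being a homomorphism and a
    left inverse of [phi].

    The bialgebra half is formal. The cocycle identity says that [ad] is a representation on
    tensors, co-Jacobi reduces to Yang-Baxter up to cyclic rotation ([delta_r_co_jacobi]), and
    coherence passes from r-matrices to cobrackets ([coherent_rmatrix_bialgebra]). When [phi] is
    bijective, its inverse serves as [psi], and [theta^-1] enters the inverses of the two maps. *)

Section Tensors.
Variable K : fieldType.
Implicit Types V W Z : vectType K.

(** * Tensors as finite sums of pure tensors *)

Lemma linear_opp V W (f : V -> W) v : linear f -> f (- v) = - f v.
Proof. by move=> lin_f; rewrite -(linfunE lin_f) linearN -?(linfunE lin_f). Qed.

Lemma linear_add V W (f : V -> W) u v : linear f -> f (u + v) = f u + f v.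
Proof. by move=> lin_f; rewrite -!(linfunE lin_f) linearD. Qed.

Lemma linear_sub V W (f : V -> W) u v : linear f -> f (u - v) = f u - f v.
Proof. by move=> lin_f; rewrite linear_add // linear_opp. Qed.

Lemma linear_scale V W (f : V -> W) c v : linear f -> f (c *: v) = c *: f v.
Proof. by move=> lin_f; rewrite -!(linfunE lin_f) linearZ. Qed.

Lemma linear_zero V W (f : V -> W) : linear f -> f 0 = 0.
Proof. by move=> lin_f; rewrite -(linfunE lin_f) linear0. Qed.

Lemma linear_bigsum V W (f : V -> W) (I : finType) (v : I -> V) :
  linear f -> f (\sum_i v i) = \sum_i f (v i).
Proof.
move=> lin_f; rewrite -(linfunE lin_f) linear_sum.
by apply: eq_bigr => i _; exact: (linfunE lin_f).
Qed.

Lemma sum_linear V W (I : finType) (F : I -> V -> W) :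
  (forall i, linear (F i)) -> linear (fun v => \sum_i F i v).
Proof.
move=> linF c u v; rewrite scaler_sumr -big_split /=.
by apply: eq_bigr => i _; rewrite linF.
Qed.

Lemma id_linear V : linear (id : V -> V).
Proof. by []. Qed.

Lemma pureZDl V W c (u v : V) (w : W) :
  pure (c *: u + v) w = c *: pure u w + pure v w.
Proof. exact: (pure_bilinear V W).1. Qed.

Lemma pureZDr V W c (v : V) (w w' : W) :
  pure v (c *: w + w') = c *: pure v w + pure v w'.
Proof. exact: (pure_bilinear V W).2. Qed.

Lemma pure_linearl V W (w : W) : linear (fun v : V => pure v w).
Proof. exact: (pure_bilinear V W).1. Qed.

Lemma pure_linearr V W (v : V) : linear (@pure K V W v).
Proof. exact: (pure_bilinear V W).2. Qed.

Lemma pureBl V W (u v : V) (w : W) : pure (u - v) w = pure u w - pure v w.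
Proof. exact: linear_sub (pure_linearl w). Qed.

Lemma pureBr V W (v : V) (w w' : W) : pure v (w - w') = pure v w - pure v w'.
Proof. exact: linear_sub (pure_linearr v). Qed.

Lemma pureNl V W (v : V) (w : W) : pure (- v) w = - pure v w.
Proof. exact: linear_opp (pure_linearl w). Qed.

Lemma pureNr V W (v : V) (w : W) : pure v (- w) = - pure v w.
Proof. exact: linear_opp (pure_linearr v). Qed.

Lemma pure0l V W (w : W) : pure (0 : V) w = 0.
Proof. exact: linear_zero (pure_linearl w). Qed.

Lemma pure0r V W (v : V) : pure v (0 : W) = 0.
Proof. exact: linear_zero (pure_linearr v). Qed.

Lemma pureDr V W (v : V) (w w' : W) : pure v (w + w') = pure v w + pure v w'.
Proof. exact: linear_add (pure_linearr v). Qed.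

Lemma pure_sumr V W (I : finType) (v : V) (w : I -> W) :
  pure v (\sum_i w i) = \sum_i pure v (w i).
Proof. exact: linear_bigsum (pure_linearr v). Qed.

Lemma tlift_sum V W Z (beta : V -> W -> Z) (I : finType) (v : I -> V)
    (w : I -> W) : is_bilinear beta ->
  tlift beta (\sum_i pure (v i) (w i)) = \sum_i beta (v i) (w i).
Proof.
move=> betaL; rewrite (linear_bigsum _ (tlift_linear betaL)).
by apply: eq_bigr => i _; rewrite tliftE.
Qed.

(** Replaces Sweedler notation: identities about an arbitrary tensor become identities between
    finite sums. *)
Lemma tensor_sum V W (t : tensor V W) :
  exists n (v : 'I_n -> V) (w : 'I_n -> W), t = \sum_i pure (v i) (w i).
Proof.
exists (\dim {:V}), (fun i => (vbasis {:V})`_i).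
by eexists; exact: (tensor_expand t (vbasisP _)).
Qed.

Lemma tensor_ext V W Z (f g : tensor V W -> Z) :
  linear f -> linear g -> (forall v w, f (pure v w) = g (pure v w)) -> f =1 g.
Proof.
move=> lin_f lin_g fg t; have [n [v [w ->]]] := tensor_sum t.
by rewrite !linear_bigsum //; apply: eq_bigr => i _; rewrite fg.
Qed.

(** For a fixed tensor, [tlift] is a finite sum of values of [beta], so it inherits linearity in any
    further argument. *)
Lemma tlift_parameter_linear (U : vectType K) V W Z (beta : U -> V -> W -> Z) t :
  (forall v w, linear (fun u => beta u v w)) ->
  linear (fun u => tlift (beta u) t).
Proof. by move=> betaL; apply: sum_linear => i; apply: betaL. Qed.

(** Each of the three Yang-Baxter brackets is a lift nested in a lift; this evaluates all of
    them. *)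
Lemma tlift2_sum V W V' W' Z (beta : V -> W -> V' -> W' -> Z)
    (I J : finType) (v : I -> V) (w : I -> W) (v' : J -> V') (w' : J -> W') :
  (forall x y, is_bilinear (beta x y)) ->
  (forall x y, is_bilinear (fun u z => beta u z x y)) ->
  tlift (fun x y => tlift (beta x y) (\sum_j pure (v' j) (w' j)))
    (\sum_i pure (v i) (w i)) =
  \sum_i \sum_j beta (v i) (w i) (v' j) (w' j).
Proof.
move=> betaR betaL; rewrite tlift_sum.
  by apply: eq_bigr => i _; rewrite tlift_sum.
split=> x; apply: tlift_parameter_linear => y z; [exact: (betaL y z).1|].
exact: (betaL y z).2.
Qed.

Lemma tmap_bilinear V W V' W' (f : V -> V') (g : W -> W') :
  linear f -> linear g -> is_bilinear (fun v w => pure (f v) (g w)).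
Proof.
by move=> lin_f lin_g; split=> [w c v v'|v c w w'];
  rewrite (lin_f, lin_g) (pureZDl, pureZDr).
Qed.

Lemma tmap_pure V W V' W' (f : V -> V') (g : W -> W') v w :
  linear f -> linear g -> tmap f g (pure v w) = pure (f v) (g w).
Proof.
move=> lin_f lin_g; exact: (tliftE _ _ (tmap_bilinear lin_f lin_g)).
Qed.

Lemma tmap_linear V W V' W' (f : V -> V') (g : W -> W') :
  linear f -> linear g -> linear (tmap f g).
Proof. by move=> lin_f lin_g; apply: tlift_linear; apply: tmap_bilinear. Qed.

Lemma tmap_sum V W V' W' (f : V -> V') (g : W -> W') (I : finType)
    (v : I -> V) (w : I -> W) : linear f -> linear g ->
  tmap f g (\sum_i pure (v i) (w i)) = \sum_i pure (f (v i)) (g (w i)).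
Proof. by move=> lin_f lin_g; apply: tlift_sum; apply: tmap_bilinear. Qed.

Lemma tmap_comp V W V' W' V'' W'' (f : V -> V') (g : W -> W')
    (f' : V' -> V'') (g' : W' -> W'') t :
  linear f -> linear g -> linear f' -> linear g' ->
  tmap f' g' (tmap f g t) = tmap (f' \o f) (g' \o g) t.
Proof.
move=> lf lg lf' lg'; have [n [v [w ->]]] := tensor_sum t.
rewrite !tmap_sum //; move=> c x y /=; first by rewrite lf lf'.
by rewrite lg lg'.
Qed.

Lemma eq_tmap V W V' W' (f f' : V -> V') (g g' : W -> W') t :
  f =1 f' -> g =1 g' -> tmap f g t = tmap f' g' t.
Proof. by move=> ff gg; apply: eq_bigr => i _; rewrite ff gg. Qed.

Lemma flip_bilinear V W : is_bilinear (fun (v : V) (w : W) => pure w v).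
Proof. by split=> u c x y; rewrite (pureZDl, pureZDr). Qed.

Lemma flip_linear V W : linear (@flip K V W).
Proof. exact: tlift_linear (flip_bilinear V W). Qed.

Lemma flip_pure V W (v : V) (w : W) : flip (pure v w) = pure w v.
Proof. exact: tliftE (flip_bilinear V W). Qed.

Lemma flipK V W : cancel (@flip K V W) (@flip K W V).
Proof.
apply: tensor_ext => [c x y|//|v w]; first by rewrite !flip_linear.
by rewrite !flip_pure.
Qed.

Lemma rot3_inner_bilinear V (a : V) :
  is_bilinear (fun b c : V => pure b (pure c a)).
Proof. by split=> u k x y; rewrite !(pureZDl, pureZDr). Qed.

Lemma rot3_bilinear V :
  is_bilinear (fun a : V => tlift (fun b c : V => pure b (pure c a))).
Proof.
split=> [t|a]; last exact: tlift_linear (rot3_inner_bilinear a).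
by apply: tlift_parameter_linear => b c k x y; rewrite !pureZDr.
Qed.

Lemma rot3_linear V : linear (@rot3 K V).
Proof. exact: tlift_linear (rot3_bilinear V). Qed.

Lemma rot3_pure V (a b c : V) :
  rot3 (pure a (pure b c)) = pure b (pure c a).
Proof.
rewrite /rot3 (tliftE _ _ (rot3_bilinear V)).
exact: tliftE (rot3_inner_bilinear a).
Qed.

Lemma rot3K V (t : tensor V (tensor V V)) : rot3 (rot3 (rot3 t)) = t.
Proof.
have lin_rot c u v := rot3_linear c (u : tensor V (tensor V V)) v.
move: t; apply: tensor_ext => [c x y|//|a s]; first by rewrite !lin_rot.
move: s; apply: tensor_ext => [c x y|c x y|b c].
- by rewrite pureZDr !lin_rot.
- by rewrite pureZDr.
by rewrite !rot3_pure.
Qed.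

End Tensors.

(** * The adjoint action on tensors and the cocycle identity *)

Section Coboundary.
Variables (K : fieldType) (g : lieType K).
Implicit Types (x y z : g) (r t : tensor g g).

Lemma lieZDl c (x y z : g) : lie (c *: x + y) z = c *: lie x z + lie y z.
Proof. exact: lie_linearl. Qed.

Lemma lieZDr c (x y z : g) : lie z (c *: x + y) = c *: lie z x + lie z y.
Proof. exact: lie_linearr. Qed.

Lemma tensor_ad_linear x : linear (tensor_ad x).
Proof.
move=> c t t'; rewrite /tensor_ad (tmap_linear (@id_linear K g)).
  rewrite (tmap_linear (lie_linearr x)) // scalerDr addrACA //.
exact: lie_linearr.
Qed.

Lemma tensor_ad_pure x (a b : g) :
  tensor_ad x (pure a b) = pure a (lie x b) + pure (lie x a) b.
Proof. by rewrite /tensor_ad !tmap_pure //; exact: lie_linearr. Qed.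

Lemma tensor_ad_sum x (I : finType) (a b : I -> g) :
  tensor_ad x (\sum_i pure (a i) (b i)) =
  \sum_i (pure (a i) (lie x (b i)) + pure (lie x (a i)) (b i)).
Proof.
rewrite (linear_bigsum _ (tensor_ad_linear x)).
by apply: eq_bigr => i _; rewrite tensor_ad_pure.
Qed.

Lemma tensor_ad_flip x t : tensor_ad x (flip t) = flip (tensor_ad x t).
Proof.
move: t; apply: tensor_ext => [c t t'|c t t'|a b].
- by rewrite flip_linear tensor_ad_linear.
- by rewrite tensor_ad_linear flip_linear.
rewrite flip_pure !tensor_ad_pure (linear_add _ _ (@flip_linear _ _ _)).
by rewrite !flip_pure addrC.
Qed.

Lemma delta_r_linear r : linear (delta_r r).
Proof.
have [n [a [b ->]]] := tensor_sum r => c x y.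
rewrite /delta_r !tensor_ad_sum scaler_sumr -big_split /=.
apply: eq_bigr => i _; rewrite !lieZDl pureZDr pureZDl scalerDr.
by rewrite addrACA.
Qed.

Lemma lie_lieE x y z : lie (lie x y) z = lie x (lie y z) - lie y (lie x z).
Proof.
rewrite lieC; have /eqP := lie_jacobi x y z.
by rewrite addr_eq0 => /eqP <-; rewrite (lieC z x) linearN.
Qed.

Lemma tensor_ad_lie x y t :
  tensor_ad (lie x y) t = tensor_ad x (tensor_ad y t)
                          - tensor_ad y (tensor_ad x t).
Proof.
move: t; apply: tensor_ext => [|c t t'|a b]; first exact: tensor_ad_linear.
  by rewrite !tensor_ad_linear opprD scalerBr addrACA.
rewrite !tensor_ad_pure !(linear_add _ _ (tensor_ad_linear _)).
rewrite !tensor_ad_pure !lie_lieE.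
rewrite pureBl pureBr.
(* The terms with [x] acting on one leg and [y] on the other are symmetric in [x] and [y], so they
   cancel. *)
rewrite !opprD !addrA [RHS](ACl (1*5*4*8*2*7*3*6)) /=.
by rewrite !addrK.
Qed.

Lemma delta_r_cocycle r x y :
  delta_r r (lie x y) = tensor_ad x (delta_r r y) - tensor_ad y (delta_r r x).
Proof. exact: tensor_ad_lie. Qed.

End Coboundary.

(** * The co-Jacobi identity from the Yang-Baxter equation *)

Section CoJacobi.
Variables (K : fieldType) (g : lieType K).

Lemma lie12_13_sum (I : finType) (a b : I -> g) :
  lie12_13 (\sum_i pure (a i) (b i)) =
  \sum_i \sum_j pure (lie (a i) (a j)) (pure (b i) (b j)).
Proof.
rewrite /lie12_13 (tlift2_sum (beta := fun a b c d =>
  pure (lie a c) (pure b d))) // => x y; split=> u c v w /=;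
  by rewrite ?(lieZDl, lieZDr, pureZDl, pureZDr).
Qed.

Lemma lie13_23_sum (I : finType) (a b : I -> g) :
  lie13_23 (\sum_i pure (a i) (b i)) =
  \sum_i \sum_j pure (a i) (pure (a j) (lie (b i) (b j))).
Proof.
rewrite /lie13_23 (tlift2_sum (beta := fun a b c d =>
  pure a (pure c (lie b d)))) // => x y; split=> u c v w /=;
  by rewrite ?(lieZDl, lieZDr, pureZDl, pureZDr).
Qed.

Lemma lie12_23_sum (I : finType) (a b : I -> g) :
  lie12_23 (\sum_i pure (a i) (b i)) =
  \sum_i \sum_j pure (a i) (pure (lie (b i) (a j)) (b j)).
Proof.
rewrite /lie12_23 (tlift2_sum (beta := fun a b c d =>
  pure a (pure (lie b c) d))) // => x y; split=> u c v w /=;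
  by rewrite ?(lieZDl, lieZDr, pureZDl, pureZDr).
Qed.

(** Both sums are values of [tlift beta], at [r] and at [flip r]. This allows the legs of one copy
    of [r] to be swapped inside any bilinear expression, at the cost of a sign. *)
Lemma skew_symmetric_sum (Z : vectType K) (beta : g -> g -> Z) (I : finType)
    (a b : I -> g) :
  skew_symmetric (\sum_i pure (a i) (b i)) -> is_bilinear beta ->
  \sum_i beta (a i) (b i) = - \sum_i beta (b i) (a i).
Proof.
move=> skew_r betaL; rewrite -(tlift_sum _ _ betaL) skew_r.
rewrite (linear_opp _ (tlift_linear betaL)).
rewrite (linear_bigsum _ (@flip_linear _ _ _)).
under eq_bigr => i _ do rewrite flip_pure.
by rewrite tlift_sum.
Qed.

Lemma skew_symmetric_sum2 (Z : vectType K) (beta : g -> g -> g -> g -> Z)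
    (I : finType) (a b : I -> g) :
  skew_symmetric (\sum_i pure (a i) (b i)) ->
  (forall x y, is_bilinear (beta x y)) ->
  (forall x y, is_bilinear (fun u z => beta u z x y)) ->
  \sum_i \sum_j beta (a i) (b i) (a j) (b j) =
  \sum_i \sum_j beta (b i) (a i) (b j) (a j).
Proof.
move=> skew_r betaR betaL.
rewrite (skew_symmetric_sum (beta := fun u v => \sum_j beta u v (a j) (b j))
  skew_r); last first.
  by split=> u; apply: sum_linear => j; [exact: (betaL _ _).1|exact: (betaL _ _).2].
rewrite -sumrN; apply: eq_bigr => i _.
by rewrite (skew_symmetric_sum skew_r (betaR (b i) (a i))) opprK.
Qed.

Lemma rot3_sum2 (I J : finType) (a b c : I -> J -> g) :
  rot3 (\sum_i \sum_j pure (a i j) (pure (b i j) (c i j))) =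
  \sum_i \sum_j pure (b i j) (pure (c i j) (a i j)).
Proof.
rewrite (linear_bigsum _ (@rot3_linear K g)); apply: eq_bigr => i _.
rewrite (linear_bigsum _ (@rot3_linear K g)); apply: eq_bigr => j _.
exact: rot3_pure.
Qed.

Lemma tmap_sum2 (V W V' W' : vectType K) (f : V -> V') (h : W -> W')
    (I J : finType) (v : I -> J -> V) (w : I -> J -> W) :
  linear f -> linear h ->
  tmap f h (\sum_i \sum_j pure (v i j) (w i j)) =
  \sum_i \sum_j pure (f (v i j)) (h (w i j)).
Proof.
move=> lin_f lin_h; rewrite (linear_bigsum _ (tmap_linear lin_f lin_h)).
by apply: eq_bigr => i _; rewrite tmap_sum.
Qed.

(** The cyclic sum is invariant under [rot3], whose cube is the identity, so [rot3 u] cancels [u]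
    and [rot3 (rot3 v)] cancels [v]. *)
Lemma rot3_cyclic_sum (u v : tensor g (tensor g g)) :
  let t := rot3 u - rot3 (rot3 v) - (u - v) in
  t + rot3 t + rot3 (rot3 t) = 0.
Proof.
have rot3B (w w' : tensor g (tensor g g)) : rot3 (w - w') = rot3 w - rot3 w'.
  exact: linear_sub (@rot3_linear K g).
rewrite /= !rot3B !rot3K.
move: (rot3 (rot3 u)) (rot3 (rot3 v)) (rot3 u) (rot3 v) => u2 v2 u1 v1.
rewrite !opprB !addrA [LHS](ACl (1*3*5*7*9*11*2*4*10*12*6*8)) /=.
by rewrite !addrK subrr.
Qed.

Lemma delta_r_delta_r_sum (r : tensor g g) (I : finType) (a b : I -> g) x :
  r = \sum_i pure (a i) (b i) ->
  tmap id (delta_r r) (delta_r r x) =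
  \sum_i \sum_j pure (a i) (pure (a j) (lie (lie x (b i)) (b j)))
  + \sum_i \sum_j pure (a i) (pure (lie (lie x (b i)) (a j)) (b j))
  + \sum_i \sum_j pure (lie x (a i)) (pure (a j) (lie (b i) (b j)))
  + \sum_i \sum_j pure (lie x (a i)) (pure (lie (b i) (a j)) (b j)).
Proof.
move=> rE; have lin_d := delta_r_linear r.
have lin_tmap := tmap_linear (@id_linear K g) lin_d.
have dE y : delta_r r y =
    \sum_j (pure (a j) (lie y (b j)) + pure (lie y (a j)) (b j)).
  by rewrite /delta_r rE tensor_ad_sum.
rewrite dE (linear_bigsum _ lin_tmap) -!big_split /=.
apply: eq_bigr => i _; rewrite (linear_add _ _ lin_tmap).
rewrite !(tmap_pure _ _ (@id_linear K g) lin_d).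
rewrite !dE !pure_sumr -!big_split /=; apply: eq_bigr => j _.
by rewrite !pureDr addrA.
Qed.

(* The terms with both brackets involving [x] are, up to cyclic rotation,    *)
(* [ad x] on the first leg of [r12, r13], by skew-symmetry and Jacobi; the   *)
(* others are [ad x] on the first leg of [r13, r23] + [r12, r23].            *)
Lemma delta_r_co_jacobi (r : tensor g g) x :
  skew_symmetric r -> classical_rmatrix r ->
  let t := tmap id (delta_r r) (delta_r r x) in
  t + rot3 t + rot3 (rot3 t) = 0.
Proof.
have [n [a [b rE]]] := tensor_sum r => skew_r cybe t.
have lin_ad : linear (tmap (lie x) id : _ -> tensor g (tensor g g)).
  exact: (tmap_linear (lie_linearr x) (@id_linear K _)).
pose U := \sum_i \sum_j pure (lie (lie x (a i)) (a j)) (pure (b i) (b j)).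
pose U' := \sum_i \sum_j pure (lie (lie x (a j)) (a i)) (pure (b i) (b j)).
(* Jacobi in derivation form: [[[x, a_i], a_j] - [[x, a_j], a_i] = [x, [a_i, a_j]]]. *)
have UE : U - U' = tmap (lie x) id (lie12_13 r).
  rewrite rE lie12_13_sum (tmap_sum2 _ _ (lie_linearr x) (@id_linear K _)).
  rewrite /U /U' -sumrB; apply: eq_bigr => i _.
  rewrite -sumrB; apply: eq_bigr => j _; rewrite -pureBl.
  by rewrite lie_lieE (lieC (lie x (a j))) opprK subrK.
have tE : t = rot3 U - rot3 (rot3 U') - (U - U').
  (* The two sums with [lie x] on the first leg are treated first: by Yang-Baxter they equal minus
     [ad x] on the first leg of [lie12_13 r]. *)
  rewrite /t (delta_r_delta_r_sum x rE) -[LHS]addrA; congr (_ + _); last first.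
    move/eqP: cybe; rewrite -addrA addr_eq0 => /eqP cybe; rewrite UE cybe.
    rewrite (linear_opp _ lin_ad) opprK rE lie13_23_sum lie12_23_sum.
    rewrite (linear_add _ _ lin_ad).
    by rewrite !(tmap_sum2 _ _ (lie_linearr x) (@id_linear K _)).
  rewrite rE in skew_r; rewrite /U /U' !rot3_sum2; congr (_ + _).
    apply: (skew_symmetric_sum2 (beta := fun u v w z =>
      pure u (pure w (lie (lie x v) z))) skew_r) => y z;
    by split=> ? ? ? ? /=; rewrite ?(lieZDr, lieZDl, pureZDl, pureZDr).
  (* Here only one copy of [r] has its legs swapped, so the sign survives; in the previous sum both
     were swapped. *)
  rewrite (skew_symmetric_sum (beta := fun u v => \sum_j
    pure u (pure (lie (lie x v) (a j)) (b j))) skew_r); last first.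
    split=> y; apply: sum_linear => j ? ? ?;
    by rewrite ?(lieZDr, lieZDl, pureZDl, pureZDr).
  by rewrite exchange_big.
rewrite tE; exact: rot3_cyclic_sum.
Qed.

End CoJacobi.

(** * From r-matrices to Lie bialgebras *)

Section CoboundaryBialgebras.
Variable K : fieldType.

(** The form [s - flip s] is what survives in characteristic 2: [ad x] commutes with [flip], so
    every cobracket is again an antisymmetrization. *)
Lemma lie_bialgebra_delta_r (g : lieType K) (r s : tensor g g) :
  r = s - flip s -> classical_rmatrix r -> lie_bialgebra (delta_r r).
Proof.
move=> rE cybe; have skew_r : skew_symmetric r.
  by rewrite /skew_symmetric rE (linear_sub _ _ (@flip_linear _ _ _)) flipK opprB.
split; first exact: delta_r_linear.
- move=> x; exists (tensor_ad x s).
  by rewrite /delta_r rE (linear_sub _ _ (tensor_ad_linear x)) tensor_ad_flip.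
- by move=> x; apply: delta_r_co_jacobi.
exact: delta_r_cocycle.
Qed.

(* Intertwining lets [ad] be moved across [Phi] and [Psi] on either leg, so  *)
(* both coalgebra conditions reduce to the two conditions on the r-matrices. *)
Lemma coherent_rmatrix_bialgebra (g h : lieType K) (rg : tensor g g)
    (rh : tensor h h) (Phi : 'Hom(g, h)) (Psi : 'Hom(h, g)) :
  lie_bialgebra (delta_r rg) -> lie_bialgebra (delta_r rh) ->
  coherent_rmatrix_hom rg rh Phi Psi ->
  coherent_bialgebra_hom (delta_r rg) (delta_r rh) Phi Psi.
Proof.
move=> bg bh [_ homPhi legl legr inter].
have linPhi : linear Phi by exact: linearP.
have linPsi : linear Psi by exact: linearP.
have inter' y x : Psi (lie y (Phi x)) = lie (Psi y) x.
  by rewrite lieC (linear_opp _ linPsi) inter -lieC.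
split=> //.
- move=> y; rewrite /delta_r /tensor_ad (linear_add _ _ (tmap_linear linPsi linPsi)).
  rewrite !tmap_comp //; try exact: lie_linearr.
  congr (_ + _).
    transitivity (tmap id (Psi \o lie y) (tmap Psi id rh)).
      rewrite tmap_comp //; move=> c u v /=; by rewrite lieZDr linPsi.
    rewrite legl tmap_comp //; last by move=> c u v /=; rewrite lieZDr linPsi.
    by apply: eq_tmap => // z /=; rewrite inter'.
  transitivity (tmap (Psi \o lie y) id (tmap id Psi rh)).
    rewrite tmap_comp //; move=> c u v /=; by rewrite lieZDr linPsi.
  rewrite legr tmap_comp //; last by move=> c u v /=; rewrite lieZDr linPsi.
  by apply: eq_tmap => // z /=; rewrite inter'.
move=> x; rewrite /delta_r /tensor_ad.
rewrite (linear_add _ _ (tmap_linear (@id_linear K g) linPhi)).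
rewrite (linear_add _ _ (tmap_linear linPsi (@id_linear K h))).
rewrite !tmap_comp //; try exact: lie_linearr.
congr (_ + _).
  transitivity (tmap id (lie (Phi x)) (tmap id Phi rg)).
    rewrite tmap_comp //; last exact: lie_linearr.
    by apply: eq_tmap => // z /=; rewrite homPhi.
  by rewrite -legl tmap_comp //; exact: lie_linearr.
transitivity (tmap (lie x) id (tmap id Phi rg)).
  by rewrite tmap_comp //; exact: lie_linearr.
rewrite -legl tmap_comp //; last exact: lie_linearr.
by apply: eq_tmap => // z /=; rewrite inter.
Qed.

End CoboundaryBialgebras.

(** * The Yang-Baxter equation for a canonical skew tensor *)

Section DoubleYangBaxter.
Variables (K : fieldType) (g : lieType K) (I : finType).
(** Abstracts the double: [E] is the dual basis, [F] the basis and [P i j] the product of two basis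
    vectors. [lieFE_dual] records, in summed form, that the action on covectors is minus the
    transpose of left multiplication. *)
Variables (E F : I -> g) (P : I -> I -> g).
Hypothesis lieEE : forall i j, lie (E i) (E j) = 0.
Hypothesis lieFF : forall i j, lie (F i) (F j) = P i j - P j i.
Hypothesis lieFE_dual : forall (Z : vectType K) (beta : g -> g -> Z) k,
  is_bilinear beta ->
  \sum_i beta (lie (F k) (E i)) (F i) = - \sum_i beta (E i) (P k i).

(** The number is the leg carrying the product. Unprimed sums multiply the factors in the cyclic
    order of the remaining two legs, primed ones in the opposite order. *)
Let S1 := \sum_i \sum_j pure (P i j) (pure (E i) (E j)).
Let S1' := \sum_i \sum_j pure (P j i) (pure (E i) (E j)).
Let S2 := \sum_i \sum_j pure (E i) (pure (P j i) (E j)).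
Let S2' := \sum_i \sum_j pure (E i) (pure (P i j) (E j)).
Let S3 := \sum_i \sum_j pure (E i) (pure (E j) (P i j)).
Let S3' := \sum_i \sum_j pure (E i) (pure (E j) (P j i)).

(** Indexing by [I + I] writes the difference as one sum of pure tensors, with the sign absorbed in
    the first leg. *)
Let a (k : I + I) := match k with inl i => E i | inr i => - F i end.
Let b (k : I + I) := match k with inl i => F i | inr i => E i end.

Fact skew_canonical_sum :
  \sum_i (pure (E i) (F i) - pure (F i) (E i)) = \sum_k pure (a k) (b k).
Proof.
rewrite big_sumType big_split /=; congr (_ + _).
by apply: eq_bigr => i _; rewrite pureNl.
Qed.

Lemma lieNl (x y : g) : lie (- x) y = - lie x y.
Proof. by rewrite lieC (linear_opp _ (lie_linearr y)) opprK lieC. Qed.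

Lemma lieNr (x y : g) : lie x (- y) = - lie x y.
Proof. exact: linear_opp (lie_linearr x). Qed.

Lemma dual_pair_sum (Z : vectType K) (beta : I -> g -> g -> Z) :
  (forall k, is_bilinear (beta k)) ->
  \sum_k \sum_i beta k (lie (F k) (E i)) (F i) =
  - \sum_k \sum_i beta k (E i) (P k i).
Proof. by move=> betaL; rewrite -sumrN; apply: eq_bigr => k _; rewrite lieFE_dual. Qed.

Ltac solve_bilinear := move=> ?; split=> ? ? ? ? /=;
  by rewrite ?(pureZDl, pureZDr).

Fact lie12_13_canonical :
  lie12_13 (\sum_k pure (a k) (b k)) = - S2 + S3' + (S1 - S1').
Proof.
rewrite lie12_13_sum big_sumType /=.
under eq_bigr => i _ do rewrite big_sumType /=.
under [X in _ + X]eq_bigr => i _ do rewrite big_sumType /=.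
(* Of the four blocks, the one bracketing two covectors vanishes; the mixed ones go through
   [dual_pair_sum] and the last through [lieFF]. *)
rewrite !big_split /= big1 ?add0r; last first.
  by move=> i _; rewrite big1 // => j _; rewrite lieEE pure0l.
rewrite -addrA; congr (_ + (_ + _)).
- rewrite exchange_big.
  under eq_bigr => k _ do under eq_bigr => i _ do rewrite lieNr lieC opprK.
  rewrite (dual_pair_sum (beta := fun k u v => pure u (pure v (E k)))).
    by rewrite exchange_big.
  solve_bilinear.
- under eq_bigr => k _ do under eq_bigr => i _ do rewrite lieNl pureNl.
  under eq_bigr => k _ do rewrite sumrN.
  rewrite sumrN (dual_pair_sum (beta := fun k u v => pure u (pure (E k) v))).
    by rewrite opprK exchange_big.
  solve_bilinear.
rewrite -sumrB; apply: eq_bigr => i _; rewrite -sumrB.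
by apply: eq_bigr => j _; rewrite lieNl lieNr opprK lieFF pureBl.
Qed.

Fact lie13_23_canonical :
  lie13_23 (\sum_k pure (a k) (b k)) = S3 - S3' + S2' - S1.
Proof.
rewrite lie13_23_sum big_sumType /=.
under eq_bigr => i _ do rewrite big_sumType /=.
under [X in _ + X]eq_bigr => i _ do rewrite big_sumType /=.
rewrite !big_split /= [X in _ + (_ + X)]big1 ?addr0; last first.
  by move=> i _; rewrite big1 // => j _; rewrite lieEE !pure0r.
congr (_ + _ + _).
- rewrite -sumrB; apply: eq_bigr => i _; rewrite -sumrB.
  by apply: eq_bigr => j _; rewrite lieFF !pureBr.
- under eq_bigr => k _ do under eq_bigr => i _ do rewrite pureNl pureNr.
  under eq_bigr => k _ do rewrite sumrN.
  rewrite sumrN (dual_pair_sum (beta := fun k u v => pure (E k) (pure v u))).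
    by rewrite opprK.
  solve_bilinear.
rewrite exchange_big.
under eq_bigr => k _ do under eq_bigr => i _ do
  rewrite lieC pureNl !pureNr opprK.
rewrite (dual_pair_sum (beta := fun k u v => pure v (pure (E k) u))) //.
solve_bilinear.
Qed.

Fact lie12_23_canonical :
  lie12_23 (\sum_k pure (a k) (b k)) = - S3 - (S2' - S2) + S1'.
Proof.
rewrite lie12_23_sum big_sumType /=.
under eq_bigr => i _ do rewrite big_sumType /=.
under [X in _ + X]eq_bigr => i _ do rewrite big_sumType /=.
rewrite !big_split /= [X in _ + (X + _)]big1 ?add0r; last first.
  by move=> i _; rewrite big1 // => j _; rewrite lieEE pure0l pure0r.
congr (_ + _ + _).
- rewrite (dual_pair_sum (beta := fun k u v => pure (E k) (pure u v))) //.
  solve_bilinear.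
- rewrite -sumrB -sumrN; apply: eq_bigr => i _; rewrite -sumrB -sumrN.
  apply: eq_bigr => j _.
  by rewrite lieNr lieFF pureNl pureNr pureBl pureBr.
rewrite exchange_big.
under eq_bigr => k _ do under eq_bigr => i _ do
  rewrite lieNr lieC opprK pureNl.
under eq_bigr => k _ do rewrite sumrN.
rewrite sumrN (dual_pair_sum (beta := fun k u v => pure v (pure u (E k)))).
  by rewrite opprK exchange_big.
solve_bilinear.
Qed.

Lemma canonical_classical_rmatrix :
  classical_rmatrix (\sum_i (pure (E i) (F i) - pure (F i) (E i))).
Proof.
rewrite skew_canonical_sum /classical_rmatrix.
rewrite lie12_13_canonical lie13_23_canonical lie12_23_canonical.
move: S1 S1' S2 S2' S3 S3' => s1 s1' s2 s2' s3 s3'.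
rewrite opprB !addrA [LHS](ACl (10*2*3*5*7*12*4*11*9*8*6*1)) /=.
by rewrite !addrK subrr.
Qed.

End DoubleYangBaxter.

(** * The canonical r-matrix of a pre-Lie algebra *)

Section PreLieDoubles.
Variable K : fieldType.
Implicit Types A B : preLieType K.

(** Expanding the transposed covectors in the dual basis of [X], and the images [f X_i] in [Y],
    makes both sides the same double sum weighted by the matrix entries of [f]. *)
Lemma canonical_sum_transpose (V W Z : vectType K) (f : 'Hom(V, W))
    (beta : dual V -> W -> Z) m n (X : m.-tuple V) (Y : n.-tuple W) :
  is_bilinear beta -> basis_of {:V} X -> basis_of {:W} Y ->
  \sum_j beta (transpose f (cobasis Y j)) Y`_j =
  \sum_i beta (cobasis X i) (f X`_i).
Proof.
move=> [betal betar] basisX basisY.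
under eq_bigr => j _ do rewrite (cobasis_expand (transpose f (cobasis Y j))
  basisX) (linear_comb _ _ (betal _)).
rewrite exchange_big /=; apply: eq_bigr => i _.
rewrite (coord_basis basisY (memvf (f X`_i))) (linear_comb _ _ (betar _)).
by apply: eq_bigr => j _; rewrite transposeE cobasisE.
Qed.

Definition inA A (x : A) : prelie_double A := sd_inl (dual_rep (Lrep A)) x.
Definition inA' A (xi : dual A) : prelie_double A :=
  sd_inr (dual_rep (Lrep A)) xi.

Lemma inA_linear A : linear (@inA A).
Proof. by move=> c x y; congr (_, _); rewrite /= scaler0 addr0. Qed.

Lemma inA'_linear A : linear (@inA' A).
Proof. by move=> c x y; congr (_, _); rewrite /= scaler0 addr0. Qed.

Lemma lie_inA A (x y : A) :
  lie (inA x) (inA y) = inA (plmul x y) - inA (plmul y x).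
Proof.
rewrite -(linear_sub _ _ (@inA_linear A)); congr (_, _).
by rewrite !linear0 addr0.
Qed.

Lemma lie_inA' A (xi zeta : dual A) : lie (inA' xi) (inA' zeta) = 0.
Proof.
have rho0 := linear_zero (dual_map_linear (Lrep A)).
congr (_, _); rewrite /= ?lie0l // rho0.
by rewrite !zero_lfunE subrr.
Qed.

Lemma lie_inA_inA' A (x : A) (xi : dual A) :
  lie (inA x) (inA' xi) = inA' (- transpose (linfun (plmul x)) xi).
Proof.
congr (_, _); rewrite /= ?linear0 //.
by rewrite addr0 opp_lfunE.
Qed.

Let e A (i : 'I_(\dim {:A})) : A := (vbasis {:A})`_i.
Let e' A (i : 'I_(\dim {:A})) : dual A := cobasis (vbasis {:A}) i.

(** The dual-basis identity for left multiplication by [x]; it supplies the hypothesis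
    [lieFE_dual]. *)
Lemma lie_inA_inA'_sum A (Z : vectType K)
    (beta : prelie_double A -> prelie_double A -> Z) (x : A) :
  is_bilinear beta ->
  \sum_i beta (lie (inA x) (inA' (@e' A i))) (inA (@e A i)) =
  - \sum_i beta (inA' (@e' A i)) (inA (plmul x (@e A i))).
Proof.
move=> [betal betar].
pose gam (xi : dual A) (y : A) := beta (inA' xi) (inA y).
have gamL : is_bilinear gam.
  by split=> y c u v; rewrite /gam (inA_linear, inA'_linear) (betal, betar).
under eq_bigr => i _.
  rewrite lie_inA_inA' -[beta _ _]/(gam _ _) (linear_opp _ (gamL.1 _)).
  over.
rewrite sumrN (canonical_sum_transpose _ gamL (vbasisP _) (vbasisP _)).
by under eq_bigr => i _ do rewrite lfunE.
Qed.

Lemma r_id_classical A : classical_rmatrix (r_id A).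
Proof.
apply: (canonical_classical_rmatrix (E := fun i => inA' (@e' A i))
  (F := fun i => inA (@e A i)) (P := fun i j => inA (plmul (@e A i) (@e A j)))).
- by move=> i j; rewrite lie_inA'.
- by move=> i j; rewrite lie_inA.
by move=> Z beta k betaL; rewrite lie_inA_inA'_sum.
Qed.

Lemma r_id_antisymmetrization A :
  exists s : tensor (prelie_double A) (prelie_double A), r_id A = s - flip s.
Proof.
exists (\sum_i pure (inA' (@e' A i)) (inA (@e A i))).
rewrite (linear_bigsum _ (@flip_linear _ _ _)) -sumrB.
by apply: eq_bigr => i _; rewrite flip_pure.
Qed.

Lemma r_id_skew_rmatrix A : skew_rmatrix (r_id A).
Proof.
split; last exact: r_id_classical.
have [s ->] := r_id_antisymmetrization A.
by rewrite /skew_symmetric (linear_sub _ _ (@flip_linear _ _ _)) flipK opprB.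
Qed.

Lemma r_id_lie_bialgebra A : lie_bialgebra (delta_r (r_id A)).
Proof.
have [s rE] := r_id_antisymmetrization A.
exact: lie_bialgebra_delta_r rE (r_id_classical A).
Qed.

Lemma tmap_r_id A (Z W : vectType K) (f : prelie_double A -> Z)
    (h : prelie_double A -> W) :
  linear f -> linear h ->
  tmap f h (r_id A) = \sum_i pure (f (inA' (@e' A i))) (h (inA (@e A i)))
    - \sum_i pure (f (inA (@e A i))) (h (inA' (@e' A i))).
Proof.
move=> lf lh; rewrite (linear_bigsum _ (tmap_linear lf lh)) -sumrB.
apply: eq_bigr => i _; rewrite (linear_sub _ _ (tmap_linear lf lh)).
by rewrite !tmap_pure.
Qed.

(** * The pair of maps between the doubles *)

Section DoubleMap.
Variables (A B : preLieType K) (f : 'Hom(A, B)) (f' : 'Hom(dual A, dual B)).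

Lemma double_inA (x : A) : double_map f f' (inA x) = inA (f x).
Proof. by rewrite /double_map sd_mapE; congr (_, _); rewrite linear0. Qed.

Lemma double_inA' (xi : dual A) : double_map f f' (inA' xi) = inA' (f' xi).
Proof. by rewrite /double_map sd_mapE; congr (_, _); rewrite linear0. Qed.

End DoubleMap.

Variables (A B : preLieType K) (phi : 'Hom(A, B)) (psi : 'Hom(B, A)).
Variable theta : K.

Let Phi := double_map phi (theta *: transpose psi).
Let Psi := double_map (theta *: psi) (transpose phi).

Let linPhi : linear Phi. Proof. exact: linearP. Qed.
Let linPsi : linear Psi. Proof. exact: linearP. Qed.

Lemma pureZ_inA_inA' (x : A) (xi : dual B) c :
  pure (inA (c *: x)) (inA' xi) = pure (inA x) (inA' (c *: xi)).
Proof.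
have [cx cxi] := (linear_scale c x (@inA_linear A),
                  linear_scale c xi (@inA'_linear B)).
by rewrite cx cxi (linear_scale _ _ (pure_linearl _))
  (linear_scale _ _ (pure_linearr _)).
Qed.

Lemma pureZ_inA'_inA (x : A) (xi : dual B) c :
  pure (inA' xi) (inA (c *: x)) = pure (inA' (c *: xi)) (inA x).
Proof.
have [cx cxi] := (linear_scale c x (@inA_linear A),
                  linear_scale c xi (@inA'_linear B)).
by rewrite cx cxi (linear_scale _ _ (pure_linearl _))
  (linear_scale _ _ (pure_linearr _)).
Qed.

(** The half with covectors on the left is the dual-basis identity for [phi]; the other half is the
    one for [psi], read backwards, after [theta] has moved from the vector to the covector. *)
Lemma r_id_left_leg : tmap Psi id (r_id B) = tmap id Phi (r_id A).
Proof.
rewrite (tmap_r_id linPsi (@id_linear K _)) (tmap_r_id (@id_linear K _) linPhi); congr (_ - _).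
  under eq_bigr => i _ do rewrite double_inA'.
  under [RHS]eq_bigr => i _ do rewrite double_inA.
  apply: (canonical_sum_transpose _ (beta := fun xi y => pure (inA' xi) (inA y)));
    try exact: vbasisP.
  by split=> ? ? ? ?; rewrite (inA_linear, inA'_linear) (pureZDl, pureZDr).
under eq_bigr => i _ do rewrite double_inA scale_lfunE pureZ_inA_inA'.
under [RHS]eq_bigr => i _ do rewrite double_inA' scale_lfunE.
apply/esym.
apply: (canonical_sum_transpose _ (beta := fun xi y =>
  pure (inA y) (inA' (theta *: xi)))); try exact: vbasisP.
split=> ? ? ? ?; last by rewrite inA_linear pureZDl.
by rewrite scalerDr scalerA mulrC -scalerA inA'_linear pureZDr.
Qed.

Lemma r_id_right_leg : tmap id Psi (r_id B) = tmap Phi id (r_id A).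
Proof.
rewrite (tmap_r_id (@id_linear K _) linPsi) (tmap_r_id linPhi (@id_linear K _)); congr (_ - _).
  under eq_bigr => i _ do rewrite double_inA scale_lfunE pureZ_inA'_inA.
  under [RHS]eq_bigr => i _ do rewrite double_inA' scale_lfunE.
  apply/esym.
  apply: (canonical_sum_transpose _ (beta := fun xi y =>
    pure (inA' (theta *: xi)) (inA y))); try exact: vbasisP.
  split=> ? ? ? ?; last by rewrite inA_linear pureZDr.
  by rewrite scalerDr scalerA mulrC -scalerA inA'_linear pureZDl.
under eq_bigr => i _ do rewrite double_inA'.
under [RHS]eq_bigr => i _ do rewrite double_inA.
apply: (canonical_sum_transpose _ (beta := fun xi y => pure (inA y) (inA' xi)));
  try exact: vbasisP.
by split=> ? ? ? ?; rewrite (inA_linear, inA'_linear) (pureZDl, pureZDr).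
Qed.

Hypotheses (phi_hom : prelie_hom phi) (psi_hom : prelie_hom psi).
Hypothesis phiK : cancel phi psi.

(** On covectors, [xi (psi (plmul (phi x) y)) = xi (plmul x (psi y))], so the transpose of [psi]
    intertwines the two actions. Covectors commute, so [theta] occurs only linearly. *)
Lemma double_lie_hom : lie_hom Phi.
Proof.
move=> p q; rewrite /Phi /double_map !sd_mapE; congr (_, _) => /=.
  by rewrite !lie_subadjacentE linearB /= !phi_hom.
apply/dualP => y; rewrite !scale_lfunE !pairing_simp transposeE !pairing_simp.
rewrite !dual_mapE !pairing_simp !transposeE !lfunE /= !psi_hom !phiK.
by rewrite mulrBr !mulrN.
Qed.

(** The factor [theta] that [Phi] puts on the covectors of [p] matches the one that [Psi] puts on
    the vector part of [q]. *)
Lemma double_intertwining p q : Psi (lie (Phi p) q) = lie p (Psi q).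
Proof.
rewrite /Phi /Psi /double_map !sd_mapE; congr (_, _) => /=.
  rewrite !scale_lfunE !lie_subadjacentE linearB /= !psi_hom !phiK.
  by rewrite plmulZl linearZ scalerBr.
apply/dualP => x; rewrite !(transposeE, pairing_simp, dual_mapE).
rewrite !scale_lfunE !(transposeE, pairing_simp, dual_mapE) !lfunE /=.
by rewrite plmulZl psi_hom phiK phi_hom !pairing_simp.
Qed.

Lemma double_coherent_rmatrix_hom :
  coherent_rmatrix_hom (r_id A) (r_id B) Phi Psi.
Proof.
split; [by split; exact: r_id_skew_rmatrix | exact: double_lie_hom
       | exact: r_id_left_leg | exact: r_id_right_leg
       | exact: double_intertwining].
Qed.

Lemma double_coherent_bialgebra_hom :
  coherent_bialgebra_hom (delta_r (r_id A)) (delta_r (r_id B)) Phi Psi.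
Proof.
apply: coherent_rmatrix_bialgebra; try exact: r_id_lie_bialgebra.
exact: double_coherent_rmatrix_hom.
Qed.

End PreLieDoubles.

Lemma double_map_cancel (K : fieldType) (A B : preLieType K) (f : 'Hom(A, B))
    (f' : 'Hom(dual A, dual B)) (h : 'Hom(B, A)) (h' : 'Hom(dual B, dual A)) :
  cancel f h -> cancel f' h' -> cancel (double_map f f') (double_map h h').
Proof.
by move=> fK f'K [x xi]; rewrite /double_map !sd_mapE /= fK f'K.
Qed.

Lemma transposeK (K : fieldType) (V W : vectType K) (f : 'Hom(V, W))
    (h : 'Hom(W, V)) : cancel f h -> cancel (transpose h) (transpose f).
Proof. by move=> fK xi; apply/dualP => v; rewrite !transposeE fK. Qed.

Lemma scale_lfunK (K : fieldType) (V W : vectType K) (f : 'Hom(V, W))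
    (h : 'Hom(W, V)) (c d : K) :
  d * c = 1 -> cancel f h -> cancel (c *: f) (d *: h).
Proof.
by move=> dc1 fK v; rewrite !scale_lfunE linearZ /= scalerA dc1 scale1r fK.
Qed.

Theorem proposition4p23 (K : fieldType) (A B : preLieType K)
    (phi : 'Hom(A, B)) (phi_hom : prelie_hom phi)
    (theta : K) (theta_neq0 : theta != 0) :
  (forall psi : 'Hom(B, A), prelie_hom psi -> (psi \o phi)%VF = \1%VF ->
    let Phi := double_map phi (theta *: transpose psi) in
    let Psi := double_map (theta *: psi) (transpose phi) in
    coherent_rmatrix_hom (r_id A) (r_id B) Phi Psi /\
    coherent_bialgebra_hom (delta_r (r_id A)) (delta_r (r_id B)) Phi Psi) /\
  (bijective phi ->
    let Phi := double_map phi (theta *: transpose phi^-1%VF) in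
    let Psi := double_map (theta *: phi^-1%VF) (transpose phi) in
    coherent_rmatrix_iso (r_id A) (r_id B) Phi Psi /\
    coherent_bialgebra_iso (delta_r (r_id A)) (delta_r (r_id B)) Phi Psi).
Proof.
split=> [psi psi_hom psi_phi Phi Psi | phi_bij Phi Psi].
  have phiK : cancel phi psi by move=> x; rewrite -comp_lfunE psi_phi id_lfunE.
  split; [exact: double_coherent_rmatrix_hom | exact: double_coherent_bialgebra_hom].
(* The vector-space inverse is a left inverse because the kernel is trivial; bijectivity makes it
   two-sided. *)
have phiK : cancel phi phi^-1%VF.
  move=> x; apply: lker0_lfunK; apply/lker0P; exact: bij_inj phi_bij.
have phiVK : cancel phi^-1%VF phi by apply/(bij_can_sym phi_bij).
have phiV_hom : prelie_hom phi^-1%VF.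
  by move=> x y; apply: (can_inj phiK); rewrite phi_hom !phiVK.
have Phi_bij : bijective Phi.
  (* The transposes of [phi] and of its inverse are mutually inverse, so only the scalar has to be
     inverted on the covector summand; for [Psi] it is inverted on the vector summand. *)
  exists (double_map phi^-1%VF (theta^-1 *: transpose phi)).
    apply: double_map_cancel => //.
    exact: scale_lfunK (mulVf theta_neq0) (transposeK phiK).
  apply: double_map_cancel => //.
  exact: scale_lfunK (mulfV theta_neq0) (transposeK phiVK).
have Psi_bij : bijective Psi.
  exists (double_map (theta^-1 *: phi) (transpose phi^-1%VF)).
    apply: double_map_cancel; last exact: transposeK.
    exact: scale_lfunK (mulVf theta_neq0) phiVK.
  apply: double_map_cancel; last exact: transposeK.
  exact: scale_lfunK (mulfV theta_neq0) phiK.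
split; split=> //.
  exact: double_coherent_rmatrix_hom.
exact: double_coherent_bialgebra_hom.
Qed.
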